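(* Let $k$ be a field of characteristic different from $2,3$, and work over $k(r,s,t)$. Let $H_j(x)=h_{2j}x^2+h_{1j}x+h_{0j}$ and $\lambda_j$ ($j=1,\dots,4$), $G_1$, $\delta_i$ ($i=1,\dots,7$), $\Delta$ and $\widetilde{\mathcal{C}}_{rst}$ be as in the context. Define the matrix $$A=\begin{pmatrix} h_{21} & h_{22} & h_{23} & h_{24} \\ h_{11} & h_{12} & h_{13} & h_{14} \\ h_{01} & h_{02} & h_{03} & h_{04} \\ -\frac r2 & -\frac12 & -\frac{\delta_3}2 & -\frac{\delta_5}2 \end{pmatrix}.$$ Then $\det(A)=\Delta$. Let $M$ be the cofactor matrix of $A$, i.e. $M^T=\det(A)A^{-1}$, with entries $M_{ij}$, and define $$\widetilde{A}=\begin{pmatrix} M_{31} & M_{32} & M_{33} & M_{34} \\ -2M_{21} & -2M_{22} & -2M_{23} & -2M_{24} \\ M_{11} & M_{12} & M_{13} & M_{14} \\ \frac12M_{41} & \frac12M_{42} & \frac12M_{43} & \frac12M_{44} \end{pmatrix},$$ $$\widetilde{H}_j(x)=\widetilde{A}_{1j}x^2+\widetilde{A}_{2j}x+\widetilde{A}_{3j}\quad(j=1,\dots,4),$$ $$\tilde\lambda_1=\lambda_1\Delta/\delta_6^2,\quad\tilde\lambda_2=\lambda_2\Delta/\delta_7^2,\quad\tilde\lambda_3=\lambda_3\Delta\delta_3^2/\delta_4^2,\quad\tilde\lambda_4=\lambda_4\Delta\delta_5^2,$$ $$\widetilde{G}_4(x)=\Delta\bigl(G_1(x)-2t\bigr).$$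 Then there exist polynomials $\widetilde{G}_1,\widetilde{G}_2,\widetilde{G}_3\in k(r,s,t)[x]$, determined up to sign, with $$\widetilde{G}_i(x)^2=\widetilde{G}_4(x)^2+\tilde\lambda_4\widetilde{H}_4(x)^3-\tilde\lambda_i\widetilde{H}_i(x)^3\quad(i=1,2,3),$$ and the curve $\widetilde{\mathcal{C}}_{rst}$ is the same (up to rescaling $y$ by a constant) as $$y^2=-3\Bigl(\widetilde{G}_i(x)^2+\tilde\lambda_i\widetilde{H}_i(x)^3\Bigr)\quad\text{for each } i=1,\dots,4.$$
   Context: Polynomials: $H_1=x^2+rx+t$, $H_2=x^2+x+r$, $H_3=sx^2+(2sr-st-1)x+sr^2$, $H_4=(str-st-sr^2+sr+r)x^2+(st^2-str-st-sr^3+2sr^2+t)x+st^2-str^2-str+sr^3+t$. Constants: $\lambda_1=4s$, $\lambda_2=4st$, $\lambda_3=4t/(st+1)^2$, $\lambda_4=4st/(st^2-3str+st+sr^3+t)^2$. $G_1=(s-st-1)x^3+3s(r-t)x^2+3sr(r-t)x-st^2+sr^3+t$. $$\begin{aligned} \delta_1&=s,\quad\delta_2=t,\quad\delta_3=st+1,\quad\delta_4=r^3-3rt+t^2+t,\quad\delta_5=r^3s-3rst+st^2+st+t,\\ \delta_6&=r^3s^2-3rs^2t-3rs+s^2t^2+s^2t+2st+s+1,\\ \delta_7&=r^3s^2t+r^3s-3rs^2t^2-3rst+s^2t^3+s^2t^2+2st^2+t,\\ \Delta&=r^6s^2-6r^4s^2t-3r^4s+2r^3s^2t^2+2r^3s^2t+3r^3st+r^3s+r^3+9r^2s^2t^2+6r^2st\\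 &\quad-6rs^2t^3-6rs^2t^2-9rst^2-3rst-3rt+s^2t^4+2s^2t^3+s^2t^2+2st^3+3st^2+t^2+t. \end{aligned}$$ The curve $\widetilde{\mathcal{C}}_{rst}$ over $k(r,s,t)$ is $$-3y^2=\Delta^2\big((s-st-1)x^3+3s(r-t)x^2+3rs(r-t)x+(r^3s-st^2-t)\big)^2+4\Delta st\,h(x)^3,$$ with $h(x)=(r-1)(rs-st-1)x^2+(r^3s-2r^2s+rst+r-st^2+st-t)x-(r^2-t)(rs-st-1)$. (It is the genus $2$ curve whose Jacobian is the quotient $\mathcal{J}_{rst}/\Sigma$ of the Jacobian of $\mathcal{C}_{rst}\colon y^2=G_1^2+\lambda_1H_1^3$ by a maximal isotropic $\Sigma\simeq(\mathbb{Z}/3)^2$.) *)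

(* Defs.v *)
From mathcomp Require Import all_boot all_order all_algebra.
From mathcomp Require Import mpoly.
Set Implicit Arguments.
Unset Strict Implicit.
Unset Printing Implicit Defensive.
Import GRing.Theory.
Local Open Scope ring_scope.

(* The function field k(r,s,t) is {fraction {mpoly k[3]}}. *)
Definition rX (k : fieldType) : {fraction {mpoly k[3]}} :=
  tofrac ('X_(0 : 'I_3) : {mpoly k[3]}).
Definition sX (k : fieldType) : {fraction {mpoly k[3]}} :=
  tofrac ('X_(1 : 'I_3) : {mpoly k[3]}).
Definition tX (k : fieldType) : {fraction {mpoly k[3]}} :=
  tofrac ('X_(2 : 'I_3) : {mpoly k[3]}).

(* The cofactor matrix, i.e. the transpose of the adjugate. *)
Definition cofactor_mx (R : comPzRingType) (n : nat) (B : 'M[R]_n) : 'M[R]_n :=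
  \matrix_(i, j) cofactor B i j.

Lemma tr_cofactor_mx (F : fieldType) (n : nat) (B : 'M[F]_n) :
  B \in unitmx -> (cofactor_mx B)^T = \det B *: invmx B.
Proof.
move=> uB; have -> : (cofactor_mx B)^T = \adj B by apply/matrixP=> i j; rewrite !mxE.
by rewrite /invmx uB scalerA mulrV ?scale1r // -unitmxE.
Qed.

(* The affine plane curve a y^2 = f(x), as its defining polynomial
   in F[x][y]: the outer variable is y, the inner one x. *)
Definition curve (F : fieldType) (a : F) (f : {poly F}) : {poly {poly F}} :=
  a%:P *: 'X^2 - f%:P.

(* C(x, c y) and D(x, y) define the same curve, for some nonzero constant c:
   they are equal up to a nonzero constant factor u. *)
Definition same_up_to_y_rescaling (F : fieldType) (C D : {poly {poly F}}) :
    Prop :=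
  exists c u : F,
    [/\ c != 0, u != 0 & C \Po (c%:P *: 'X) = u%:P *: D].

(* Families indexed by 1, ..., 4 are indexed here by 'I_4 = {0, ..., 3}, and
   likewise for the rows and columns of 4 x 4 matrices. *)
Section Curves.
Variables (F : fieldType) (r s t : F).

Definition H (j : 'I_4) : {poly F} := nth 0
  [:: 'X^2 + r *: 'X + t%:P;
      'X^2 + 'X + r%:P;
      s *: 'X^2 + (2 * s * r - s * t - 1) *: 'X + (s * r ^+ 2)%:P;
      (s * t * r - s * t - s * r ^+ 2 + s * r + r) *: 'X^2
      + (s * t ^+ 2 - s * t * r - s * t - s * r ^+ 3 + 2 * s * r ^+ 2 + t)
          *: 'X
      + (s * t ^+ 2 - s * t * r ^+ 2 - s * t * r + s * r ^+ 3 + t)%:P] j.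

Definition lambda (j : 'I_4) : F := nth 0
  [:: 4 * s;
      4 * s * t;
      4 * t / (s * t + 1) ^+ 2;
      4 * s * t
        / (s * t ^+ 2 - 3 * s * t * r + s * t + s * r ^+ 3 + t) ^+ 2] j.

Definition G1 : {poly F} :=
  (s - s * t - 1) *: 'X^3 + (3 * s * (r - t)) *: 'X^2
  + (3 * s * r * (r - t)) *: 'X + (- s * t ^+ 2 + s * r ^+ 3 + t)%:P.

Definition delta3 : F := s * t + 1.
Definition delta4 : F := r ^+ 3 - 3 * r * t + t ^+ 2 + t.
Definition delta5 : F :=
  r ^+ 3 * s - 3 * r * s * t + s * t ^+ 2 + s * t + t.
Definition delta6 : F :=
  r ^+ 3 * s ^+ 2 - 3 * r * s ^+ 2 * t - 3 * r * s + s ^+ 2 * t ^+ 2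
  + s ^+ 2 * t + 2 * s * t + s + 1.
Definition delta7 : F :=
  r ^+ 3 * s ^+ 2 * t + r ^+ 3 * s - 3 * r * s ^+ 2 * t ^+ 2 - 3 * r * s * t
  + s ^+ 2 * t ^+ 3 + s ^+ 2 * t ^+ 2 + 2 * s * t ^+ 2 + t.

Definition Delta : F :=
  r ^+ 6 * s ^+ 2 - 6 * r ^+ 4 * s ^+ 2 * t - 3 * r ^+ 4 * s
  + 2 * r ^+ 3 * s ^+ 2 * t ^+ 2 + 2 * r ^+ 3 * s ^+ 2 * t
  + 3 * r ^+ 3 * s * t + r ^+ 3 * s + r ^+ 3
  + 9 * r ^+ 2 * s ^+ 2 * t ^+ 2 + 6 * r ^+ 2 * s * t
  - 6 * r * s ^+ 2 * t ^+ 3 - 6 * r * s ^+ 2 * t ^+ 2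
  - 9 * r * s * t ^+ 2 - 3 * r * s * t - 3 * r * t
  + s ^+ 2 * t ^+ 4 + 2 * s ^+ 2 * t ^+ 3 + s ^+ 2 * t ^+ 2
  + 2 * s * t ^+ 3 + 3 * s * t ^+ 2 + t ^+ 2 + t.

Definition h : {poly F} :=
  ((r - 1) * (r * s - s * t - 1)) *: 'X^2
  + (r ^+ 3 * s - 2 * r ^+ 2 * s + r * s * t + r - s * t ^+ 2 + s * t - t)
      *: 'X
  - ((r ^+ 2 - t) * (r * s - s * t - 1))%:P.

Definition Ctilde : {poly {poly F}} :=
  curve (-3)
    (Delta ^+ 2 *:
       ((s - s * t - 1) *: 'X^3 + (3 * s * (r - t)) *: 'X^2
        + (3 * r * s * (r - t)) *: 'X
        + (r ^+ 3 * s - s * t ^+ 2 - t)%:P) ^+ 2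
     + (4 * Delta * s * t) *: h ^+ 3).

Definition A : 'M[F]_4 := \matrix_(i, j) nth 0
  [:: (H j)`_2;
      (H j)`_1;
      (H j)`_0;
      - ([:: r; 1; delta3; delta5]`_j / 2)] i.

Definition M : 'M[F]_4 := cofactor_mx A.

Definition Atilde : 'M[F]_4 := \matrix_(i, j) nth 0
  [:: M 2 j;
      - 2 * M 1 j;
      M 0 j;
      2^-1 * M 3 j] i.

Definition Htilde (j : 'I_4) : {poly F} :=
  Atilde 0 j *: 'X^2 + Atilde 1 j *: 'X + (Atilde 2 j)%:P.

Definition lambdatilde (j : 'I_4) : F := nth 0
  [:: lambda 0 * Delta / delta6 ^+ 2;
      lambda 1 * Delta / delta7 ^+ 2;
      lambda 2 * Delta * delta3 ^+ 2 / delta4 ^+ 2;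
      lambda 3 * Delta * delta5 ^+ 2] j.

Definition G4tilde : {poly F} := Delta *: (G1 - (2 * t)%:P).

End Curves.

(* Main.v *)
(* The fourth polynomial tilde H_4 is h itself.  The remaining tilde G_i were
   found by factoring tilde G_4^2 + tilde lambda_4 tilde H_4^3
   - tilde lambda_i tilde H_i^3: up to the factor Delta, each one differs from
   G_1 (or, for i = 1, from G_1 - 2t + 2x^3) by a multiple of the cube of a
   linear form in x.  All remaining assertions are then polynomial identities in
   r, s, t, x, together with the nonvanishing of the delta_i, which is seen by
   specializing (r, s, t) to points with coordinates 0 and 1. *)
Require Import Defs.
From mathcomp Require Import all_boot all_order all_algebra.
From mathcomp Require Import mpoly ring.
Import GRing.Theory.
Local Open Scope ring_scope.

(** * Quadratic polynomials and explicit Laplace expansion *)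

Lemma coef_quadratic (R : nzRingType) (a b c : R) (i : nat) :
  (a *: 'X^2 + b *: 'X + c%:P)`_i = nth 0 [:: c; b; a] i.
Proof.
rewrite !coefD !coefZ coefXn coefX coefC.
by case: i => [|[|[|i]]] /=; rewrite ?nth_nil ?mulr0 ?mulr1 ?addr0 ?add0r.
Qed.

(** Laplace expansion along the first row. With entries indexed by [nat], minors are taken through
    [bump], which computes on numerals, so a concrete determinant unfolds to a closed expression. *)
Fixpoint natdet {R : comNzRingType} (n : nat) (f : nat -> nat -> R) : R :=
  if n is m.+1 then
    \sum_(j < n) (-1) ^+ j * f 0 j * natdet m (fun a b => f a.+1 (bump j b))
  else 1.

Lemma cofactor_natmx (R : comNzRingType) (n : nat) (f : nat -> nat -> R)
    (i j : 'I_n.+1) :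
  cofactor (\matrix_(a, b) f a b) i j =
  (-1) ^+ (i + j) * \det (\matrix_(a < n, b < n) f (bump i a) (bump j b)).
Proof.
by rewrite /cofactor; congr (_ * \det _); apply/matrixP=> a b; rewrite !mxE.
Qed.

Lemma det_natmx (R : comNzRingType) (n : nat) (f : nat -> nat -> R) :
  \det (\matrix_(a < n, b < n) f a b) = natdet n f.
Proof.
elim: n f => [|n IHn] f; first by rewrite det_mx00.
rewrite (expand_det_row _ 0); apply: eq_bigr => j _.
rewrite mxE cofactor_natmx (IHn (fun a b => f a.+1 (bump j b))) add0n.
by rewrite mulrCA mulrA.
Qed.

(** * Nonvanishing in k(r,s,t) by specialization *)

Section Specialization.
Variable k : fieldType.

Lemma tofrac_neq0_meval (n : nat) (v : 'I_n -> k) (p : {mpoly k[n]}) :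
  p.@[v] != 0 -> tofrac p != 0.
Proof.
by apply: contraNneq => /eqP; rewrite tofrac_eq0 => /eqP->; rewrite meval0.
Qed.

(** Carries the assumption on the characteristic from k to its function field: the constant p keeps
    its value under evaluation at the origin. *)
Lemma natr_frac_neq0 {n p : nat} :
  p%:R != 0 :> k -> p%:R != 0 :> {fraction {mpoly k[n]}}.
Proof.
move=> pn0; rewrite -[p%:R]/(1 *+ p) -tofrac1 -tofracMn.
by apply: (@tofrac_neq0_meval _ (fun=> 0)); rewrite mevalMn meval1.
Qed.

Local Notation r := (rX k).
Local Notation s := (sX k).
Local Notation t := (tX k).

(** The goal is first folded back into [tofrac] of one polynomial, then evaluated. Each point used
    below gives the value exactly 1, hence a nonzero value in every characteristic. *)
Ltac specialize_to a b c :=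
  rewrite /rX /sX /tX -?tofrac1
    -!(tofracMn, tofracXn, tofracM, tofracN, tofracD);
  apply: (@tofrac_neq0_meval _ (fun i : 'I_3 => [:: a; b; c]`_i));
  rewrite !(mevalD, mevalN, mevalM, rmorphXn, mevalMn, meval1, mevalXU) /=;
  match goal with |- is_true (?e != _) =>
    have -> : e = 1 by ring end;
  exact: oner_neq0.

Lemma delta3_neq0 : delta3 s t != 0.
Proof. by rewrite /delta3; specialize_to (0 : k) (0 : k) (0 : k). Qed.

Lemma delta4_neq0 : delta4 r t != 0.
Proof. by rewrite /delta4; specialize_to (1 : k) (0 : k) (0 : k). Qed.

Lemma delta5_neq0 : delta5 r s t != 0.
Proof. by rewrite /delta5; specialize_to (0 : k) (0 : k) (1 : k). Qed.

Lemma delta6_neq0 : delta6 r s t != 0.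
Proof. by rewrite /delta6; specialize_to (0 : k) (0 : k) (0 : k). Qed.

Lemma delta7_neq0 : delta7 r s t != 0.
Proof. by rewrite /delta7; specialize_to (0 : k) (0 : k) (1 : k). Qed.

End Specialization.

(** * The matrix A and the quadratics tilde H_j, over any field where 2 is invertible *)

Section Identities.
Context {F : fieldType} (r s t : F).
Hypothesis two_neq0 : 2%:R != 0 :> F.

Definition Aentry (i j : nat) : F := nth 0 (nth [::]
 [:: [:: 1; 1; s; s * t * r - s * t - s * r ^+ 2 + s * r + r];
     [:: r; 1; 2 * s * r - s * t - 1;
         s * t ^+ 2 - s * t * r - s * t - s * r ^+ 3 + 2 * s * r ^+ 2 + t];
     [:: t; r; s * r ^+ 2;
         s * t ^+ 2 - s * t * r ^+ 2 - s * t * r + s * r ^+ 3 + t];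
     [:: - (r / 2); - (1 / 2); - (delta3 s t / 2); - (delta5 r s t / 2)]] i) j.

Lemma A_entries : A r s t = \matrix_(i, j) Aentry i j.
Proof.
apply/matrixP=> i j; rewrite !mxE.
(* The unit coefficients left implicit in H_1 and H_2 are made visible so that [coef_quadratic]
   applies. *)
have HE a b : 'X^2 + a *: 'X + b%:P = 1 *: 'X^2 + a *: 'X + b%:P :> {poly F}
  by rewrite scale1r.
have HE1 b : 'X^2 + 'X + b%:P = 1 *: 'X^2 + 1 *: 'X + b%:P :> {poly F}
  by rewrite !scale1r.
by case: j => -[|[|[|[|//]]]] ? /=; rewrite /H /= ?HE ?HE1 !coef_quadratic;
  case: i => -[|[|[|[|//]]]] ?.
Qed.

Lemma M_entries (i j : 'I_4) :
  M r s t i j =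
  (-1) ^+ (i + j) * natdet 3 (fun a b => Aentry (bump i a) (bump j b)).
Proof. by rewrite mxE A_entries cofactor_natmx -det_natmx. Qed.

Lemma det_A : \det (A r s t) = Delta r s t.
Proof.
rewrite A_entries det_natmx /= !big_ord_recr !big_ord0 /=.
rewrite /Aentry /bump /= /Delta /delta3 /delta5.
by field.
Qed.

Lemma HtildeE (j : 'I_4) : Htilde r s t j =
  M r s t 2 j *: 'X^2 + (- 2 * M r s t 1 j) *: 'X + (M r s t 0 j)%:P.
Proof. by congr (_ *: _ + _ *: _ + _%:P); rewrite mxE. Qed.

Lemma Htilde3 : Htilde r s t 3 = h r s t.
Proof.
rewrite HtildeE /h !M_entries /= !big_ord_recr !big_ord0 /=.
rewrite /Aentry /bump /= /delta3 /delta5.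
by rewrite -polyCN; congr (_ *: _ + _ *: _ + _%:P); field.
Qed.

(** The halves from the last row of A cancel in the cofactors. The resulting integral coefficients
    let [ring] prove the square identities below without division. *)
Lemma Htilde0 : Htilde r s t 0 =
  (- r ^+ 4 * s ^+ 2 + 6 * r ^+ 2 * s ^+ 2 * t + 3 * r ^+ 2 * s
   - 4 * r * s ^+ 2 * t ^+ 2 - 4 * r * s ^+ 2 * t - 5 * r * s * t - r * s - r
   + s ^+ 2 * t ^+ 3 + s ^+ 2 * t ^+ 2 + s ^+ 2 * t + 2 * s * t ^+ 2 + s * t
   + t) *: 'X^2
  + (- r ^+ 5 * s ^+ 2 + 6 * r ^+ 3 * s ^+ 2 * t + 3 * r ^+ 3 * s
     - 3 * r ^+ 2 * s ^+ 2 * t ^+ 2 - 5 * r ^+ 2 * s ^+ 2 * t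
     - 4 * r ^+ 2 * s * t - r ^+ 2 * s - r ^+ 2 + r * s ^+ 2 * t ^+ 2
     + 2 * r * s ^+ 2 * t + r * s * t + s ^+ 2 * t ^+ 3 - s ^+ 2 * t ^+ 2
     + 2 * s * t ^+ 2 - s * t + t) *: 'X
  + (- t * (r - 1) * (r * s - s * t - 1) ^+ 2)%:P.
Proof.
rewrite HtildeE !M_entries /= !big_ord_recr !big_ord0 /=.
rewrite /Aentry /bump /= /delta3 /delta5.
by congr (_ *: _ + _ *: _ + _%:P); field.
Qed.

Lemma Htilde1 : Htilde r s t 1 =
  ((r ^+ 2 - t) * (r * s - s * t - 1) ^+ 2) *: 'X^2
  + (2 * r ^+ 5 * s ^+ 2 - r ^+ 4 * s ^+ 2 * t - r ^+ 4 * s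
     - 5 * r ^+ 3 * s ^+ 2 * t - r ^+ 3 * s + r ^+ 2 * s ^+ 2 * t ^+ 2
     + r ^+ 2 * s * t + r * s ^+ 2 * t ^+ 3 + 6 * r * s ^+ 2 * t ^+ 2
     + 2 * r * s * t ^+ 2 + 3 * r * s * t + r * t - 3 * s ^+ 2 * t ^+ 3
     - s ^+ 2 * t ^+ 2 - 4 * s * t ^+ 2 - t) *: 'X
  + (r ^+ 6 * s ^+ 2 - 4 * r ^+ 4 * s ^+ 2 * t - r ^+ 4 * s
     + r ^+ 3 * s ^+ 2 * t ^+ 2 + r ^+ 3 * s * t + 6 * r ^+ 2 * s ^+ 2 * t ^+ 2
     + 3 * r ^+ 2 * s * t - 4 * r * s ^+ 2 * t ^+ 3 - r * s ^+ 2 * t ^+ 2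
     - 5 * r * s * t ^+ 2 - r * t + s ^+ 2 * t ^+ 4 + 2 * s * t ^+ 3
     + t ^+ 2)%:P.
Proof.
rewrite HtildeE !M_entries /= !big_ord_recr !big_ord0 /=.
rewrite /Aentry /bump /= /delta3 /delta5.
by congr (_ *: _ + _ *: _ + _%:P); field.
Qed.

Lemma Htilde2 : Htilde r s t 2 =
  (s * (r - 1) ^+ 2 * (r ^+ 2 - t)) *: 'X^2
  + (- 3 * r ^+ 4 * s + 3 * r ^+ 3 * s * t + 2 * r ^+ 3 * s + r ^+ 3
     + 3 * r ^+ 2 * s * t - 6 * r * s * t ^+ 2 - 3 * r * s * t - 3 * r * t
     + s * t ^+ 3 + 3 * s * t ^+ 2 + t ^+ 2 + t) *: 'X
  + (- s * (r - 1) * (r ^+ 2 - t) ^+ 2)%:P.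
Proof.
rewrite HtildeE !M_entries /= !big_ord_recr !big_ord0 /=.
rewrite /Aentry /bump /= /delta3 /delta5.
by congr (_ *: _ + _ *: _ + _%:P); field.
Qed.

(** * Square identities with denominators cleared *)

Let u := r * s - s * t - 1.

(** This is the identity sought for tilde G_1, divided by Delta and multiplied by delta_6^2; tilde
    G_1 is Delta / delta_6 times the polynomial squared on the right. The next two lemmas treat
    tilde G_2 and tilde G_3 in the same way, with delta_7 and delta_4. *)
Lemma square_identity0 :
  (delta6 r s t)%:P ^+ 2 *
    ((Delta r s t)%:P * (G1 r s t - (2 * t)%:P) ^+ 2
     + (4 * s * t)%:P * h r s t ^+ 3)
  - (4 * s)%:P * Htilde r s t 0 ^+ 3 =
  (Delta r s t)%:P *
  ((delta6 r s t)%:P * (G1 r s t - (2 * t)%:P + 2 * 'X^3)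
   - (2 * t)%:P * (u%:P - (s * (r - 1))%:P * 'X) ^+ 3) ^+ 2.
Proof.
rewrite Htilde0 /h /G1 /Delta /delta6 /u -!mul_polyC.
ring.
Qed.

Lemma square_identity1 :
  (delta7 r s t)%:P ^+ 2 *
    ((Delta r s t)%:P * (G1 r s t - (2 * t)%:P) ^+ 2
     + (4 * s * t)%:P * h r s t ^+ 3)
  - (4 * s * t)%:P * Htilde r s t 1 ^+ 3 =
  (Delta r s t)%:P *
  ((delta7 r s t)%:P * G1 r s t
   - (2 * t)%:P * (u%:P * 'X + (s * (r ^+ 2 - t))%:P) ^+ 3) ^+ 2.
Proof.
rewrite Htilde1 /h /G1 /Delta /delta7 /u -!mul_polyC.
ring.
Qed.

Lemma square_identity2 :
  (delta4 r t)%:P ^+ 2 *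
    ((Delta r s t)%:P * (G1 r s t - (2 * t)%:P) ^+ 2
     + (4 * s * t)%:P * h r s t ^+ 3)
  - (4 * t)%:P * Htilde r s t 2 ^+ 3 =
  (Delta r s t)%:P *
  ((delta4 r t)%:P * G1 r s t
   + (2 * s * t)%:P * ((r - 1)%:P * 'X - (r - t)%:P) ^+ 3) ^+ 2.
Proof.
rewrite Htilde2 /h /G1 /Delta /delta4 -!mul_polyC.
ring.
Qed.

(** * The polynomials tilde G_i and the common sextic *)

Hypothesis delta3_neq0 : delta3 s t != 0.
Hypothesis delta4_neq0 : delta4 r t != 0.
Hypothesis delta5_neq0 : delta5 r s t != 0.
Hypothesis delta6_neq0 : delta6 r s t != 0.
Hypothesis delta7_neq0 : delta7 r s t != 0.

(** The denominator of lambda_3 is delta_3^2, which the factor delta_3^2 in tilde lambda_3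
    cancels. *)
Lemma lambdatilde2 :
  lambdatilde r s t 2 = 4 * t * Delta r s t / delta4 r t ^+ 2.
Proof.
rewrite /lambdatilde /lambda /= -/(delta3 s t).
by field; rewrite delta3_neq0 delta4_neq0.
Qed.

Lemma lambdatilde3 : lambdatilde r s t 3 = 4 * s * t * Delta r s t.
Proof.
rewrite /lambdatilde /lambda /=.
have -> : s * t ^+ 2 - 3 * s * t * r + s * t + s * r ^+ 3 + t = delta5 r s t.
  by rewrite /delta5; ring.
by field.
Qed.

Definition Gtilde (i : 'I_4) : {poly F} := nth 0
  [:: (Delta r s t / delta6 r s t) *:
        ((delta6 r s t)%:P * (G1 r s t - (2 * t)%:P + 2 * 'X^3)
         - (2 * t)%:P * (u%:P - (s * (r - 1))%:P * 'X) ^+ 3);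
      (Delta r s t / delta7 r s t) *:
        ((delta7 r s t)%:P * G1 r s t
         - (2 * t)%:P * (u%:P * 'X + (s * (r ^+ 2 - t))%:P) ^+ 3);
      (Delta r s t / delta4 r t) *:
        ((delta4 r t)%:P * G1 r s t
         + (2 * s * t)%:P * ((r - 1)%:P * 'X - (r - t)%:P) ^+ 3);
      G4tilde r s t] i.

(** Multiplying the cleared identity by D / d^2 restores the denominators, since (D / d)^2 P^2 = (D
    / d^2) (D P^2). *)
Lemma sqr_of_cleared_denominator {d D l c : F} {P Q B C : {poly F}} :
    d != 0 ->
    d%:P ^+ 2 * (D%:P * Q ^+ 2 + c%:P * B) - l%:P * C = D%:P * P ^+ 2 ->
  ((D / d) *: P) ^+ 2 + (l * D / d ^+ 2) *: C =
  (D *: Q) ^+ 2 + (c * D) *: B.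
Proof.
move=> d0 eqP; have -> : ((D / d) *: P) ^+ 2 = (D / d ^+ 2) *: (D%:P * P ^+ 2).
  by rewrite exprZn mul_polyC scalerA; congr (_ *: _); field.
rewrite -eqP -!mul_polyC.
have -> : (D / d ^+ 2)%:P * (d%:P ^+ 2 * (D%:P * Q ^+ 2 + c%:P * B) - l%:P * C)
    = (D / d ^+ 2 * d ^+ 2)%:P * (D%:P * Q ^+ 2 + c%:P * B)
      - (l * D / d ^+ 2)%:P * C by ring.
by rewrite divfK ?expf_neq0 //; ring.
Qed.

(** The right-hand side does not depend on i, so the four curves share one equation and only one
    comparison with [Ctilde] remains. *)
Lemma Gtilde_sqrD (i : 'I_4) :
  Gtilde i ^+ 2 + lambdatilde r s t i *: Htilde r s t i ^+ 3 =
  G4tilde r s t ^+ 2 + (4 * s * t * Delta r s t) *: h r s t ^+ 3.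
Proof.
have [->|[->|[->|->]]] : i = 0 \/ i = 1 \/ i = 2 \/ i = 3.
  by case: i => -[|[|[|[|//]]]] lti;
    [left | right; left | do 2!right; left | do 3!right]; apply: val_inj.
- exact: sqr_of_cleared_denominator delta6_neq0 square_identity0.
- exact: sqr_of_cleared_denominator delta7_neq0 square_identity1.
- rewrite lambdatilde2.
  exact: sqr_of_cleared_denominator delta4_neq0 square_identity2.
- by rewrite lambdatilde3 Htilde3.
Qed.

Lemma Ctilde_rescaling (three_neq0 : 3%:R != 0 :> F) :
  same_up_to_y_rescaling (Ctilde r s t)
    (curve 1 ((-3) *: (G4tilde r s t ^+ 2
                       + (4 * s * t * Delta r s t) *: h r s t ^+ 3))).
Proof.
(* Replacing y by y/3 turns -3 y^2 into -y^2/3, which forces the overall factor -1/3; this factor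
   also cancels the -3 in front of the sextic. *)
exists 3^-1, (- 3^-1); split; rewrite ?oppr_eq0 ?invr_eq0 //.
rewrite /Ctilde /curve comp_polyB comp_polyZ comp_polyC comp_Xn_poly.
rewrite exprZn scalerBr !scalerA -polyC_exp -!polyCM; congr (_%:P *: _ - _).
  by field.
rewrite -[RHS]mul_polyC -polyCM; congr _%:P.
rewrite mul_polyC scalerA mulrNN mulVf // scale1r /G4tilde exprZn.
congr (_ *: _ ^+ 2 + _ *: _); last by ring.
(* The cubic in [Ctilde] is G_1 - 2t: only the constant term differs from that of G_1. *)
by rewrite /G1 -!mul_polyC; ring.
Qed.

End Identities.

(** * Assembly over the function field k(r,s,t) *)

Theorem theorem13 (k : fieldType)
    (hk2 : 2%N \notin [pchar k]) (hk3 : 3%N \notin [pchar k]) :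
  let K : fieldType := {fraction {mpoly k[3]}} in
  let r : K := rX k in let s : K := sX k in let t : K := tX k in
  let rhs (i : 'I_4) : {poly K} :=
    G4tilde r s t ^+ 2 + lambdatilde r s t 3 *: Htilde r s t 3 ^+ 3
    - lambdatilde r s t i *: Htilde r s t i ^+ 3 in
  \det (A r s t) = Delta r s t
  /\ exists Gtilde : 'I_4 -> {poly K},
       [/\ Gtilde 3 = G4tilde r s t,
           forall i : 'I_4, i != 3 ->
             Gtilde i ^+ 2 = rhs i
             /\ (forall G' : {poly K}, G' ^+ 2 = rhs i ->
                   G' = Gtilde i \/ G' = - Gtilde i)
         & forall i : 'I_4,
             same_up_to_y_rescaling (Ctilde r s t)
               (curve 1 ((-3) *: (Gtilde i ^+ 2
                  + lambdatilde r s t i *: Htilde r s t i ^+ 3)))].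
Proof.
move=> K r s t rhs.
have two_neq0 : 2%:R != 0 :> K by apply: natr_frac_neq0; move: hk2; rewrite inE.
have three_neq0 : 3%:R != 0 :> K.
  by apply: natr_frac_neq0; move: hk3; rewrite inE.
have sqrD := Gtilde_sqrD r s t two_neq0 (delta3_neq0 k) (delta4_neq0 k)
  (delta5_neq0 k) (delta6_neq0 k) (delta7_neq0 k).
split; first exact: det_A.
exists (Gtilde r s t); split=> // [i _ | i].
- have rhsE : Gtilde r s t i ^+ 2 = rhs i.
    (* Both [sqrD i] and [sqrD 3] have the same right-hand side, and [Gtilde] at index 3 is
       [G4tilde]. *)
    by apply/eqP; rewrite eq_sym subr_eq sqrD -(sqrD 3).
  (* K[x] is an integral domain, so two polynomials with equal squares agree up to sign. *)
  split=> // G' /eqP; rewrite -rhsE eqf_sqr.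
  by case/orP=> /eqP->; [left | right].
- by rewrite sqrD; exact: Ctilde_rescaling.
Qed.
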